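(* For every positive integer $n$ and every non-negative integer $d$, $$\operatorname{sxdeg}(\Sigma_{n,2d})=\operatorname{sxc}(\Sigma_{n,2d})=\binom{n+d}{n}.$$
   Context: $\mathbb{R}[\mathbf{x}]_{2d}$ denotes the finite-dimensional vector space of polynomials in $n$ variables $\mathbf{x}=(x_1,\ldots,x_n)$ with real coefficients and degree at most $2d$. A polynomial is SOS if it is a sum of finitely many squares of polynomials in $\mathbb{R}[\mathbf{x}]$. $\Sigma_{n,2d} := \{f \in \mathbb{R}[\mathbf{x}]_{2d} : f \text{ is SOS}\}$. $\mathcal{S}^j$ is the vector space of real symmetric $j\times j$ matrices and $\mathcal{S}_+^j\subseteq \mathcal{S}^j$ is the cone of positive semidefinite ones. For a closed convex cone $K$ in a finite-dimensional real vector space $E$, a subset $S$ of a real vector space $V$ has a $K$-lift if $S = \pi(K \cap H)$ for some affine subspace $H$ of $E$ and some linear map $\pi: E \to V$. The semidefinite extension complexity $\operatorname{sxc}(S)$ is the smallest positive integer $j$ such that $S$ has an $\mathcal{S}_+^j$-lift ($\infty$ if there is none). The semidefinite extension degree $\operatorname{sxdeg}(S)$ is the smallest positive integer $j$ such that $S$ has an $(\mathcal{S}_+^j)^m$-lift for some finite positive integer $m$, where $(\mathcal{S}_+^j)^m = \mathcal{S}_+^j\times\cdots\times\mathcal{S}_+^j$ ($m$ factors); $\operatorname{sxdeg}(S):=\infty$ if there is no such $j$. *)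

(* Defs.v *)
From HB Require Import structures.
From mathcomp Require Import all_boot all_order all_algebra.
From mathcomp Require Import boolp classical_sets reals.
From mathcomp Require Import mpoly.

Set Implicit Arguments.
Unset Strict Implicit.
Unset Printing Implicit Defensive.

Import Order.TTheory GRing.Theory Num.Theory.

Local Open Scope ring_scope.
Local Open Scope classical_set_scope.

Section BoundedDegree.
Variables (n k : nat) (R : comNzRingType).

(* [msize p] is 1 + deg p, and 0 for p = 0. *)
Definition deg_le : {pred {mpoly R[n]}} := [pred p | (msize p <= k.+1)%N].

Record bmpoly :=
  BMPoly { mpoly_of_bmpoly :> {mpoly R[n]}; _ : mpoly_of_bmpoly \in deg_le }.

Fact deg_le_submod_closed : submod_closed deg_le.
Proof.
split=> [|c p q]; rewrite !inE ?msize0 // => hp hq.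
apply: leq_trans (msizeD_le _ _) _; rewrite geq_max hq andbT.
exact: leq_trans (msizeZ_le _ _) hp.
Qed.

HB.instance Definition _ :=
  GRing.isSubmodClosed.Build R {mpoly R[n]} deg_le deg_le_submod_closed.

HB.instance Definition _ := [isSub for mpoly_of_bmpoly].
HB.instance Definition _ := [Choice of bmpoly by <:].
HB.instance Definition _ := [SubChoice_isSubLmodule of bmpoly by <:].

End BoundedDegree.

Section Lifts.
Variable R : realType.

Definition is_sos n (p : {mpoly R[n]}) : Prop :=
  exists s : seq {mpoly R[n]}, p = \sum_(g <- s) g ^+ 2.

Definition sos_cone n k : set (bmpoly n k R) := [set p | is_sos p].

Definition affine_subspace (E : vectType R) (H : set E) : Prop :=
  exists (a : E) (U : {vspace E}), H = [set x | x - a \in U].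

Definition has_lift (E : vectType R) (K : set E) (V : lmodType R) (S : set V)
    : Prop :=
  exists (H : set E) (pi : {linear E -> V}),
    affine_subspace H /\ S = pi @` (K `&` H).

Definition symv j : {vspace 'M[R]_j} := fixedSpace (linfun (@trmx R j j)).

Lemma memv_symv j (A : 'M[R]_j) : (A \in symv j) = (A^T == A).
Proof. by apply/fixedSpaceP/eqP; rewrite lfunE. Qed.

Definition symmx j : vectType R := subvs_of (symv j).

Definition psd j : set (symmx j) :=
  [set A | forall x : 'cV[R]_j, 0 <= (x^T *m vsval A *m x) 0 0].

Definition psd_pow j m : set {ffun 'I_m -> symmx j} :=
  [set A | forall i, psd (A i)].

(* [None] stands for infinity. *)
Definition least_pos (P : nat -> Prop) : option nat :=
  if pselect (exists j, `[< (0 < j)%N /\ P j >]) is left ex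
  then Some (ex_minn ex) else None.

Definition sxc (V : lmodType R) (S : set V) : option nat :=
  least_pos (fun j => has_lift (@psd j) S).

Definition sxdeg (V : lmodType R) (S : set V) : option nat :=
  least_pos (fun j => exists m, (0 < m)%N /\ has_lift (@psd_pow j m) S).

End Lifts.

Arguments sos_cone : clear implicits.

(* Main.v *)
Require Import Defs.
From mathcomp Require Import all_boot all_algebra reals.
From HB Require Import structures.
From mathcomp Require Import all_order boolp classical_sets cardinality.
From mathcomp Require Import finmap mpoly ring lra zify.

(** Write D = binom(n+d, n) for the number of monomials of degree at most d.

    Upper bound.  The Gram map sends a symmetric matrix A of order D to the
    polynomial x^T A x, where x is the vector of these monomials.  A positive
    semidefinite A is a sum of matrices v^T v ([psdmx_sum_sqr]) and v^T v goes to
    a square, so the image consists of sums of squares.  Conversely the summands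
    of a sum of squares of degree at most 2d have degree at most d, because the
    squares of the leading coefficients cannot cancel ([msize_sos_summand]), so
    that each of them is a combination of the D monomials.

    Lower bound.  Let a cone with m blocks of order j lift Sigma_(n,2d).  For a
    point x, the preimages of the f with f(x) = 0 form a face of the lifted
    set, because f(x) >= 0 for every sum of squares f.  Such a face is cut out
    by kernels: there are subspaces N(x,i), for i < m, such that B lies in the
    face if and only if N(x,i) is contained in the kernel of the i-th block of B
    for all i ([exists_least_kernels], [zero_of_kernels]).

    Now take an infinite sequence of points of which only finitely many lie on
    any given hypersurface of degree at most d; the points
    (s^(b^0), s^(b^1), ...) with b = d+1 have this property
    ([mpoly_eq0_infinite_zeros]).  Add points one by one to a finite set T.  By
    the pigeonhole principle the other points can be thinned out to an infinite
    set on which, for each i, either every N(x,i) or no N(x,i) is contained in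
    the sum of the N(y,i), y in T.  In the second case adding a point makes the
    i-th sum larger, which can happen at most j times.  So some T with at most
    j points absorbs, in all blocks at once, the N(x,i) of infinitely many x
    ([exists_absorbing_set]).

    If j < D, some nonzero g of degree at most d vanishes on T.  A preimage B of
    g^2 lies in the faces of all points of T, hence its kernels contain N(x,i)
    for infinitely many x, hence g vanishes at infinitely many of the points,
    which is a contradiction. *)

Set Implicit Arguments.
Unset Strict Implicit.
Unset Printing Implicit Defensive.

Import Order.TTheory GRing.Theory Num.Theory.

Local Open Scope ring_scope.
Local Open Scope classical_set_scope.

(** * Positive semidefinite matrices *)

Section Entries.
Variables (R : pzRingType) (m n : nat).
Implicit Types A B : 'M[R]_(m, n).

Lemma addmxE A B i k : (A + B) i k = A i k + B i k.
Proof. by rewrite mxE. Qed.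

Lemma diffmxE A B i k : (A - B) i k = A i k - B i k.
Proof. by rewrite !mxE. Qed.

Lemma scalemxE (a : R) A i k : (a *: A) i k = a * A i k.
Proof. by rewrite mxE. Qed.

End Entries.

Section PsdMatrices.
Variables (R : rcfType) (j : nat).
Implicit Types (A B : 'M[R]_j) (u v : 'rV[R]_j).

Definition psdmx A : Prop :=
  A^T = A /\ forall u, 0 <= (u *m A *m u^T) 0 0.

Lemma psdmx_comb A B (a b : R) : 0 <= a -> 0 <= b ->
  psdmx A -> psdmx B -> psdmx (a *: A + b *: B).
Proof.
move=> a0 b0 [sA pA] [sB pB]; split=> [|u].
  by rewrite linearD /= !linearZ /= sA sB.
rewrite mulmxDr mulmxDl -!scalemxAr -!scalemxAl.
by rewrite addmxE !scalemxE addr_ge0 ?mulr_ge0.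
Qed.

(** The quadratic polynomial t |-> (t u + v) A (t u + v)^T is nonnegative, so its
    discriminant is not positive. *)
Lemma psdmx_cauchy_schwarz A u v : psdmx A ->
  (u *m A *m v^T) 0 0 ^+ 2 <= (u *m A *m u^T) 0 0 * (v *m A *m v^T) 0 0.
Proof.
move=> [sA pA].
have sym : (v *m A *m u^T) 0 0 = (u *m A *m v^T) 0 0.
  have -> : v *m A *m u^T = (u *m A *m v^T)^T.
    by rewrite !trmx_mul trmxK sA mulmxA.
  by rewrite mxE.
pose q := Poly [:: (v *m A *m v^T) 0 0; 2 * (u *m A *m v^T) 0 0;
  (u *m A *m u^T) 0 0].
have q_ge0 x : 0 <= q.[x].
  have := pA (x *: u + v); rewrite horner_Poly /= mul0r add0r.
  rewrite linearD /= linearZ /= !(mulmxDl, mulmxDr) -!(scalemxAr, scalemxAl).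
  rewrite !(addmxE, scalemxE) sym => /le_trans; apply.
  by rewrite le_eqVlt; apply/orP; left; apply/eqP; ring.
have := deg_le2_poly_ge0 (size_Poly _ : (size q <= 3)%N) q_ge0.
rewrite !coef_Poly /= => disc; rewrite -subr_le0 -(@pmulr_rle0 _ 4) //.
by rewrite (le_trans _ disc) // le_eqVlt; apply/orP; left; apply/eqP; ring.
Qed.

(** By Cauchy-Schwarz, u A is orthogonal to every vector. *)
Lemma psdmx_ker A u : psdmx A -> (u *m A *m u^T) 0 0 = 0 -> u *m A = 0.
Proof.
move=> pA u0; apply/rowP=> i; rewrite [RHS]mxE; apply/eqP.
rewrite -sqrf_eq0 eq_le sqr_ge0 andbT.
have := psdmx_cauchy_schwarz u (delta_mx 0 i) pA.
by rewrite u0 mul0r trmx_delta -colE mxE.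
Qed.

(** If u (A + B) = 0 then the nonnegative numbers u A u^T and u B u^T add up to 0. *)
Lemma kermx_psdmxD A B : psdmx A -> psdmx B ->
  (kermx (A + B) <= kermx A)%MS.
Proof.
move=> pA pB; apply/rV_subP => u /sub_kermxP uAB; apply/sub_kermxP.
apply: psdmx_ker => //; apply/eqP; rewrite eq_le pA.2 andbT.
have <- : (u *m (A + B) *m u^T) 0 0 = 0 by rewrite uAB mul0mx mxE.
by rewrite mulmxDr mulmxDl [leRHS]mxE lerDl pB.2.
Qed.

(** Induction on the rank: if A i i > 0, subtracting (row i A)^T (row i A) / A i i
    keeps A positive semidefinite, by Cauchy-Schwarz, keeps its kernel and adds
    the i-th unit vector to it. *)
Lemma psdmx_sum_sqr A : psdmx A ->
  exists s : seq 'rV[R]_j, A = \sum_(v <- s) v^T *m v.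
Proof.
have [n] := ubnP (\rank A); elim: n A => // n IH A; rewrite ltnS => rk pA.
(* A zero diagonal forces A = 0, since every unit vector is then isotropic. *)
have [/forallP A0|/forallPn[i Ai]] := boolP [forall i, A i i == 0].
  exists [::]; rewrite big_nil; apply/row_matrixP => i; rewrite row0 rowE.
  apply: psdmx_ker => //.
  by rewrite trmx_delta -colE mxE -rowE mxE; apply/eqP.
pose e : 'rV[R]_j := delta_mx 0 i.
have Aii (u : 'rV_j) : (u *m A *m e^T) 0 0 = (u *m A) 0 i.
  by rewrite trmx_delta -colE mxE.
have AiE : (e *m A *m e^T) 0 0 = A i i.
  by rewrite Aii -rowE mxE.
have Ai_gt0 : 0 < A i i by rewrite lt_neqAle eq_sym Ai -AiE pA.2.
pose v := (Num.sqrt (A i i))^-1 *: row i A.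
pose B := A - v^T *m v.
have vv : v^T *m v = (A i i)^-1 *: ((row i A)^T *m row i A).
  rewrite /v -scalemxAr linearZ /= -scalemxAl scalerA -invfM -expr2.
  by rewrite sqr_sqrtr // ltW.
have uBu u : (u *m B *m u^T) 0 0 =
    (u *m A *m u^T) 0 0 - (A i i)^-1 * ((u *m A) 0 i) ^+ 2.
  rewrite /B vv mulmxBr mulmxBl diffmxE; congr (_ - _).
  rewrite -scalemxAr -scalemxAl scalemxE; congr (_ * _).
  have row_iE : u *m (row i A)^T = ((u *m A) 0 i)%:M.
    rewrite [LHS]mx11_scalar -Aii; congr (_ 0 0)%:M.
    by rewrite -mulmxA rowE trmx_mul pA.1.
  rewrite mulmxA row_iE mul_scalar_mx -scalemxAl scalemxE.
  have -> : row i A *m u^T = (u *m (row i A)^T)^T by rewrite trmx_mul trmxK.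
  by rewrite row_iE !mxE expr2 mulr1n.
have pB : psdmx B.
  split=> [|u].
    by rewrite /B linearB /= trmx_mul trmxK pA.1.
  have := psdmx_cauchy_schwarz u e pA.
  by rewrite Aii AiE uBu subr_ge0 ler_pdivrMl // mulrC.
have kB : (kermx A <= kermx B)%MS.
  apply/rV_subP => u /sub_kermxP uA; apply/sub_kermxP/psdmx_ker => //.
  by rewrite uBu uA mul0mx !mxE expr0n mulr0 subr0.
have [|s Bs] := IH B _ pB.
  apply: leq_trans rk; rewrite -(ltn_sub2lE _ (rank_leq_row A)) -!mxrank_ker.
  apply: rank_ltmx; rewrite ltmxE kB /=.
  apply: contra Ai => /(submx_trans _) kA.
  have /kA/sub_kermxP eA : (e <= kermx B)%MS.
    apply/sub_kermxP/psdmx_ker => //.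
    by rewrite uBu AiE -Aii AiE expr2 (mulKf (lt0r_neq0 Ai_gt0)) subrr.
  by rewrite -AiE eA mul0mx mxE.
exists (v :: s); rewrite big_cons -Bs /B.
by rewrite addrC subrK.
Qed.

End PsdMatrices.

Section PsdDomination.
Variables (R : rcfType) (j : nat).
Implicit Types (A B : 'M[R]_j) (u v : 'rV[R]_j).

(** Write B as a sum of v^T v.  Each v vanishes on the kernel of A, hence has the
    form w A, and then (u v^T)^2 = (u A w^T)^2 <= (u A u^T) (w A w^T). *)
Lemma psdmx_dominate A B : psdmx A -> psdmx B -> (kermx A <= kermx B)%MS ->
  exists2 c, 0 <= c &
    forall u, (u *m B *m u^T) 0 0 <= c * (u *m A *m u^T) 0 0.
Proof.
move=> pA pB kAB; have [s Bs] := psdmx_sum_sqr pB.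
have uBu u : (u *m B *m u^T) 0 0 = \sum_(v <- s) (u *m v^T) 0 0 ^+ 2.
  rewrite Bs mulmx_sumr mulmx_suml summxE; apply: eq_bigr => v _.
  rewrite mulmxA [u *m v^T]mx11_scalar mul_scalar_mx -scalemxAl scalemxE expr2.
  have -> : v *m u^T = (u *m v^T)^T by rewrite trmx_mul trmxK.
  by rewrite !mxE mulr1n.
(* The rows of (cokermx A)^T span the kernel of the symmetric matrix A. *)
have s_sub v : v \in s -> (v <= A)%MS.
  move=> vs; rewrite submxE; apply/eqP/trmx_inj/row_matrixP => i.
  rewrite trmx0 row0 trmx_mul row_mul; set r := row i _.
  have rA : r *m A = 0.
    by rewrite /r -row_mul -[A in _ *m A]pA.1 -trmx_mul mulmx_coker trmx0 row0.
  have /sub_kermxP rB : (r <= kermx B)%MS.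
    by apply: submx_trans kAB; apply/sub_kermxP.
  have /eqP := uBu r; rewrite rB mul0mx mxE eq_sym psumr_eq0 => [|? _].
    move=> /allP /(_ _ vs); rewrite sqrf_eq0 => /eqP rv.
    by rewrite [LHS]mx11_scalar rv -scalemx1 scale0r.
  exact: sqr_ge0.
pose w v := v *m pinvmx A.
exists (\sum_(v <- s) (w v *m A *m (w v)^T) 0 0).
  by apply: sumr_ge0 => v _; apply: pA.2.
move=> u; rewrite uBu mulr_suml !big_seq; apply: ler_sum => v vs.
rewrite mulrC; apply: le_trans (psdmx_cauchy_schwarz u (w v) pA).
rewrite -mulmxA -[A in _ *m (A *m _)]pA.1 -trmx_mul.
by rewrite /w mulmxKpV ?s_sub.
Qed.

End PsdDomination.

(** * Faces of affine sections, described by kernels *)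

Section FaceKernels.
Variables (R : rcfType) (E : lmodType R) (j m : nat).
Variables (q : 'I_m -> {linear E -> 'M[R]_j}) (H : set E).
Variable l : {scalar E}.

Let S : set E := [set A | H A /\ forall i, psdmx (q i A)].

(* H is an affine subspace, seen as a set containing the line through any two
   of its points. *)
Hypothesis H_line : forall A B t, H A -> H B -> H (A + t *: (B - A)).
Hypothesis l_ge0 : forall A, S A -> 0 <= l A.

(** By domination, A + e (A - B) still belongs to S for some e > 0.  As l A = 0,
    the value of l there is - e (l B), which forces l B <= 0. *)
Lemma zero_of_kernels A B : S A -> l A = 0 -> S B ->
  (forall i, kermx (q i A) <= kermx (q i B))%MS -> l B = 0.
Proof.
move=> [HA pA] lA SB kAB; have [HB pB] := SB.
have dom i : exists c, 0 <= c /\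
    forall u : 'rV_j, (u *m q i B *m u^T) 0 0 <= c * (u *m q i A *m u^T) 0 0.
  by have [c c0 cP] := psdmx_dominate (pA i) (pB i) (kAB i); exists c.
have [c cP] := choice dom.
(* One e for all blocks: e c i <= 1 for each of the constants c i. *)
pose e := (1 + \sum_i c i)^-1.
have c1_gt0 : 0 < 1 + \sum_i c i.
  by apply: ltr_pwDl => //; apply: sumr_ge0 => i _; have [] := cP i.
have e0 : 0 < e by rewrite invr_gt0.
have SZ : S (A + (- e) *: (B - A)).
  split=> [|i]; first exact: H_line.
  rewrite linearD linearZ linearB /=; split=> [|u].
    by rewrite linearD linearZ linearB /= (pA i).1 (pB i).1.
  rewrite !(mulmxDl, mulmxDr, mulmxBl, mulmxBr) -!(scalemxAr, scalemxAl).
  rewrite !(addmxE, scalemxE) mulmxBr mulmxBl diffmxE.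
  have [ci0 cPi] := cP i; have := cPi u; have := (pA i).2 u.
  move: ((u *m q i B *m u^T) 0 0) ((u *m q i A *m u^T) 0 0) => b a a0 ba.
  have eb : e * b <= a.
    rewrite mulrC ler_pdivrMr // (le_trans ba) // mulrC ler_wpM2l //.
    rewrite (bigD1 i) //= [leRHS]addrCA lerDl addr_ge0 ?sumr_ge0 // => k _.
    by have [] := cP k.
  rewrite mulrBr !mulNr opprK addrA addr_ge0 ?subr_ge0 //.
  exact: mulr_ge0 (ltW e0) a0.
have := l_ge0 SZ; rewrite linearD linearZ linearB /= lA add0r subr0.
rewrite mulNr oppr_ge0 pmulr_rle0 // => lB.
by apply/eqP; rewrite eq_le lB l_ge0.
Qed.

(** Take A of maximal total rank in the face.  The midpoint of A and B is again
    in the face, and each of its blocks has kernel equal to the intersection of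
    those of A and B; by maximality of the rank this intersection is the kernel
    of A. *)
Lemma exists_least_kernels : (exists2 A, S A & l A = 0) ->
  exists2 A, S A /\ l A = 0 & forall B, S B -> l B = 0 ->
    forall i, (kermx (q i A) <= kermx (q i B))%MS.
Proof.
move=> [A0 SA0 lA0].
pose P r := `[< exists A, [/\ S A, l A = 0 & (r = \sum_i \rank (q i A))%N] >].
have exP : exists r, P r.
  by exists (\sum_i \rank (q i A0))%N; apply/asboolP; exists A0.
have ubP r : P r -> (r <= \sum_(i < m) j)%N.
  by move=> /asboolP[A [_ _ ->]]; apply: leq_sum => i _; apply: rank_leq_row.
case: (ex_maxnP exP ubP) => r /asboolP[A [SA lA rA]] r_max.
exists A => // B SB lB i; have [[HA pA] [HB pB]] := (SA, SB).
pose C := A + (2^-1) *: (B - A).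
have qC k : q k C = 2^-1 *: q k A + 2^-1 *: q k B.
  rewrite linearD linearZ linearB /= scalerBr addrCA addrC; congr (_ + _).
  by rewrite -[X in X - _]scale1r -scalerBl; congr (_ *: _); lra.
have half_ge0 : 0 <= 2^-1 :> R by rewrite invr_ge0.
have rkC k : \rank (q k C) = \rank (q k A + q k B)%R.
  by rewrite qC -scalerDr mxrank_scale_nz ?invr_eq0 ?pnatr_eq0.
have rk_le k : (\rank (q k A) <= \rank (q k A + q k B)%R ?= iff
    (\rank (q k A) == \rank (q k A + q k B)%R))%N.
  split=> //; rewrite -(leq_sub2lE _ (rank_leq_row _)) -!mxrank_ker.
  exact: mxrankS (kermx_psdmxD (pA k) (pB k)).
have PC : P (\sum_k \rank (q k C))%N.
  apply/asboolP; exists C; split=> //; last first.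
    by rewrite linearD linearZ linearB /= lA lB subr0 mulr0 addr0.
  by split=> [|k]; [exact: H_line | rewrite qC; exact: psdmx_comb].
have := r_max _ PC; rewrite rA (eq_bigr _ (fun k _ => rkC k)).
rewrite (geq_leqif (leqif_sum (fun k _ => rk_le k))) => /forallP/(_ i)/eqP rki.
have le1 := kermx_psdmxD (pA i) (pB i).
have le2 : (kermx (q i A) <= kermx (q i A + q i B)%R)%MS.
  by rewrite -(mxrank_leqif_sup le1) !mxrank_ker rki.
by apply: submx_trans le2 _; rewrite addrC kermx_psdmxD.
Qed.

End FaceKernels.

(** * A finite set absorbing infinitely many subspaces *)

Section Absorption.

(** One of W /\ P i and W /\ ~ P i is infinite; treat the finitely many i in turn. *)
Lemma infinite_monochromatic (T : Type) (I : eqType) (s : seq I)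
    (P : I -> T -> Prop) (W : set T) : infinite_set W ->
  exists2 W', infinite_set W' /\ W' `<=` W &
    forall i, i \in s ->
      (forall x, W' x -> P i x) \/ (forall x, W' x -> ~ P i x).
Proof.
elim: s W => [|i s IH] W Winf; first by exists W; [split|].
have [V [Vinf VW] Vi] : exists2 V, infinite_set V /\ V `<=` W &
    (forall x, V x -> P i x) \/ (forall x, V x -> ~ P i x).
  have [fin|inf] := pselect (finite_set (W `&` [set x | P i x])); last first.
    by exists (W `&` [set x | P i x]); [split=> // x []|left=> x []].
  exists (W `&` [set x | ~ P i x]); last by right=> x [].
  split=> [fin'|x []//]; apply: Winf.
  rewrite (_ : W = (W `&` [set x | P i x]) `|` (W `&` [set x | ~ P i x])).
    by rewrite finite_setU.
  by rewrite -setIUr -[X in _ `|` X]/(~` _) setUv setIT.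
have [W' [W'inf W'V] W'P] := IH V Vinf.
exists W'; first by split=> // x /W'V /VW.
move=> k; rewrite inE => /predU1P[->|/W'P//].
by case: Vi => Vi; [left|right] => x /W'V /Vi.
Qed.

Variables (F : fieldType) (m j : nat).

(** C i is the sum of the subspaces absorbed so far in block i, and t bounds both
    the number of points still to be added and the codimension of those C i that
    do not yet absorb all of W.  After thinning W out to V, each block either
    absorbs all of V, permanently, or grows with every point of V; hence one new
    point makes progress in all unfinished blocks at once.  Quantifying over the
    upper bounds B stands for the sum of C i and of the N y i, y in T. *)
Lemma exists_absorbing_set t (N : nat -> 'I_m -> 'M[F]_j) (C : 'I_m -> 'M[F]_j)
    (W : set nat) : infinite_set W ->
  (forall i, (j <= \rank (C i) + t)%N \/ (forall x, W x -> (N x i <= C i)%MS)) ->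
  exists T : seq nat, exists2 W', (size T <= t)%N /\ infinite_set W' &
    forall x i (B : 'M[F]_j), W' x -> (C i <= B)%MS ->
      (forall y, y \in T -> (N y i <= B)%MS) -> (N x i <= B)%MS.
Proof.
elim: t C W => [|t IH] C W Winf CW.
  exists [::], W => // x i B Wx CB _; case: (CW i) => [|/(_ x Wx) NC].
    rewrite addn0 col_leq_rank => Cfull.
    by apply: submx_trans CB; apply: submx_full.
  exact: submx_trans CB.
have [V [Vinf VW] VP] := infinite_monochromatic (enum 'I_m)
  (fun i x => (N x i <= C i)%MS) Winf.
have [x0 Vx0] := infinite_setN0 Vinf.
have [||T [W' [szT W'inf] TP]] := IH (fun i => C i + N x0 i)%MS V; first by [].
  move=> i; have [NC|NC] := VP i (mem_enum _ _); [right|left] => [x Vx|].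
    by apply: submx_trans (addsmxSl _ _); apply: NC.
  have [rk|/(_ x0 (VW _ Vx0))/NC] := CW i; last by [].
  apply: leq_trans rk _; rewrite addnS -addSn leq_add2r.
  apply: rank_ltmx; rewrite ltmxE addsmxSl /=; apply/negP => le.
  by apply: (NC x0 Vx0); apply: submx_trans le; apply: addsmxSr.
exists (x0 :: T), W' => // x i B W'x CB TB.
apply: TP => // [|y yT]; last by rewrite TB // inE yT orbT.
by rewrite addsmx_sub CB TB // inE eqxx.
Qed.

End Absorption.

(** * Polynomials of bounded degree *)

(** A multinomial of degree at most d is the tuple of its exponents, each at most
    d, with sum at most d. *)
Lemma card_bmultinom n d : #|{: 'X_{1..n < d.+1}}| = 'C(n + d, n).
Proof.
rewrite -card_partial_ord_partitions.
have small (m : 'X_{1..n < d.+1}) i : (m i < d.+1)%N.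
  apply: leq_ltn_trans (bmdeg m); rewrite mdegE (bigD1 i) //=.
  exact: leq_addr.
pose f (m : 'X_{1..n < d.+1}) := [tuple inord (m i) : 'I_d.+1 | i < n].
have f_inj : injective f.
  move=> m m' e; apply/val_inj/mnmP => i.
  have := congr1 (fun t => val (tnth t i)) e.
  by rewrite !tnth_mktuple /= !inordK.
rewrite -cardsT -(card_imset _ f_inj); apply: eq_card => t; rewrite inE.
apply/imsetP/idP => [[m _ ->]|td].
  rewrite big_tuple -ltnS (leq_ltn_trans _ (bmdeg m)) // mdegE leq_eqVlt.
  by apply/orP/or_introl/eqP/eq_bigr => i _; rewrite tnth_mktuple inordK.
have md : (mdeg [multinom val (tnth t i) | i < n] < d.+1)%N.
  rewrite ltnS mdegE (leq_trans _ td) // big_tuple leq_eqVlt.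
  by apply/orP/or_introl/eqP/eq_bigr => i _; rewrite mnmE.
exists (BMultinom md) => //; apply: eq_from_tnth => i; apply: val_inj.
by rewrite tnth_mktuple /= mnmE inord_val.
Qed.

Section MonomialVector.
Variables (R : comNzRingType) (n d : nat).

Notation D := #|{: 'X_{1..n < d.+1}}|.

Definition monom (a : 'I_D) : 'X_{1..n} := bmnm (enum_val a).

Definition vec_poly (v : 'rV[R]_D) : {mpoly R[n]} := \sum_a v 0 a *: 'X_[monom a].

Lemma monom_inj : injective monom.
Proof. by move=> a b /val_inj/enum_val_inj. Qed.

Lemma mdeg_monom a : (mdeg (monom a) <= d)%N.
Proof. by rewrite -ltnS bmdeg. Qed.

Lemma monomP (m : 'X_{1..n}) : (mdeg m <= d)%N -> exists a, m = monom a.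
Proof.
rewrite -ltnS => md; exists (enum_rank (BMultinom md)).
by rewrite /monom enum_rankK.
Qed.

Lemma mcoeff_vec_poly v a : (vec_poly v)@_(monom a) = v 0 a.
Proof.
rewrite /vec_poly raddf_sum (bigD1 a) //= mcoeffZ mcoeffX eqxx mulr1.
rewrite big1 ?addr0 // => b ba.
by rewrite mcoeffZ mcoeffX (inj_eq monom_inj) (negPf ba) mulr0.
Qed.

Lemma msize_vec_poly v : (msize (vec_poly v) <= d.+1)%N.
Proof.
apply: leq_trans (msize_sum _ _ _) _; apply/bigmax_leqP => a _.
by apply: leq_trans (msizeZ_le _ _) _; rewrite msizeX ltnS mdeg_monom.
Qed.

Lemma vec_poly_coeffs (g : {mpoly R[n]}) : (msize g <= d.+1)%N ->
  vec_poly (\row_a g@_(monom a)) = g.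
Proof.
move=> gd; apply/mpolyP => m.
have [/monomP[a ->]|dm] := leqP (mdeg m) d; first by rewrite mcoeff_vec_poly mxE.
by rewrite !memN_msupp_eq0 //; apply: msize_mdeg_ge; apply: leq_trans dm;
  rewrite ?msize_vec_poly.
Qed.

End MonomialVector.

(** Fewer evaluations than monomials: the evaluation matrix has a row in its
    kernel. *)
Lemma exists_vanishing_mpoly (F : fieldType) n d (pts : seq ('I_n -> F)) :
  (size pts < #|{: 'X_{1..n < d.+1}}|)%N ->
  exists g : {mpoly F[n]}, [/\ g != 0, (msize g <= d.+1)%N &
    forall k, (k < size pts)%N -> g.@[nth (fun=> 0) pts k] = 0].
Proof.
move=> lt_pts.
pose M : 'M[F]_(#|{: 'X_{1..n < d.+1}}|, size pts) :=
  \matrix_(a, k) ('X_[monom a] : {mpoly F[n]}).@[nth (fun=> 0) pts k].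
have : kermx M != 0.
  by rewrite kermx_eq0 /row_free neq_ltn (leq_ltn_trans (rank_leq_col M)).
case/rowV0Pn => v /sub_kermxP vM v0; exists (vec_poly v); split.
- apply: contraNneq v0 => g0; apply/eqP/rowP => a.
  by rewrite -mcoeff_vec_poly g0 mcoeff0 mxE.
- exact: msize_vec_poly.
move=> k lt_k; have := congr1 (fun w : 'rV_ _ => w 0 (Ordinal lt_k)) vM.
rewrite !mxE => vMk; rewrite /vec_poly raddf_sum /= -[RHS]vMk.
by apply: eq_bigr => a _; rewrite mevalZ mxE.
Qed.

(** * Points of which finitely many lie on each hypersurface *)

Section Kronecker.
Variables (R : numDomainType) (n d : nat).

(** Kronecker substitution x_i = s^(b^i) with b = d+1: a monomial of degree at most
    d becomes a power of s, and its exponents are the base b digits of that power. *)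
Definition kron_wt (m : 'X_{1..n}) : nat := (\sum_(i < n) m i * d.+1 ^ i)%N.

Lemma digits_inj k b (f g : 'I_k -> nat) :
  (forall i, f i < b)%N -> (forall i, g i < b)%N ->
  (\sum_(i < k) f i * b ^ i = \sum_(i < k) g i * b ^ i)%N -> f =1 g.
Proof.
elim: k f g => [|k IH] f g fb gb; first by move=> _ [].
rewrite !big_ord_recl !expn0 !muln1.
have shift (h : 'I_k.+1 -> nat) : (\sum_(i < k) h (lift ord0 i) * b ^ lift ord0 i
    = b * \sum_(i < k) h (lift ord0 i) * b ^ i)%N.
  by rewrite big_distrr /=; apply: eq_bigr => i _; rewrite expnS mulnCA.
rewrite !shift => e.
have b_gt0 : (0 < b)%N := leq_ltn_trans (leq0n _) (fb ord0).
have e0 : f ord0 = g ord0.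
  have := congr1 (modn^~ b) e.
  by rewrite ![(_ + b * _)%N]addnC ![(b * _)%N]mulnC !modnMDl !modn_small.
have eS : (fun i => f (lift ord0 i)) =1 (fun i => g (lift ord0 i)).
  apply: IH => [i|i|//]; rewrite ?fb ?gb //.
  by apply/eqP; rewrite -(eqn_pmul2l b_gt0) -(eqn_add2l (f ord0)) {2}e0 e.
by move=> i; have [j ->|->] := unliftP ord0 i; [apply: eS | ].
Qed.

Lemma kron_wt_inj (m m' : 'X_{1..n}) : (mdeg m <= d)%N -> (mdeg m' <= d)%N ->
  kron_wt m = kron_wt m' -> m = m'.
Proof.
have small (m0 : 'X_{1..n}) : (mdeg m0 <= d)%N -> forall i, (m0 i < d.+1)%N.
  by move=> m0d i; rewrite ltnS (leq_trans _ m0d) // mdegE (bigD1 i) ?leq_addr.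
by move=> md m'd /digits_inj e; apply/mnmP/e; apply: small.
Qed.

Definition kron (g : {mpoly R[n]}) : {poly R} :=
  \sum_(m <- msupp g) g@_m *: 'X^(kron_wt m).

Definition kron_pt (x : R) : 'I_n -> R := fun i => x ^+ (d.+1 ^ i).

Lemma horner_kron g x : (kron g).[x] = g.@[kron_pt x].
Proof.
rewrite mevalE horner_sum; apply: eq_bigr => m _.
rewrite hornerZ hornerXn /kron_wt -prodrXr; congr (_ * _).
by apply: eq_bigr => i _; rewrite mulnC exprM.
Qed.

Lemma kron_eq0 g : (msize g <= d.+1)%N -> kron g = 0 -> g = 0.
Proof.
move=> gd kg0; apply/eqP; apply: contraT => g0.
have lg := mlead_supp g0.
have deg m : m \in msupp g -> (mdeg m <= d)%N.
  by move=> /msize_mdeg_lt mg; rewrite -ltnS (leq_trans mg).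
have := congr1 (fun p : {poly R} => p`_(kron_wt (mlead g))) kg0.
rewrite coef0 /kron coef_sum (bigD1_seq _ lg) ?msupp_uniq //=.
rewrite coefZ coefXn eqxx mulr1 big_seq_cond big1 ?addr0 => [|m].
  by move=> /eqP; rewrite mleadc_eq0 (negPf g0).
case/andP=> mg mlg; rewrite coefZ coefXn; case: eqP => [e|]; last by rewrite mulr0.
by rewrite (kron_wt_inj (deg _ lg) (deg _ mg) e) eqxx in mlg.
Qed.

(** On the curve kron_pt, g becomes a univariate polynomial with infinitely many
    roots. *)
Lemma mpoly_eq0_infinite_zeros (g : {mpoly R[n]}) (W : set nat) :
  (msize g <= d.+1)%N -> infinite_set W ->
  (forall x, W x -> g.@[kron_pt x%:R] = 0) -> g = 0.
Proof.
move=> gd Winf gW; apply: kron_eq0 => //; apply/eqP; apply: contraT => k0.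
have [B BW szB] := infinite_set_fset (size (kron g)) Winf.
pose rs : seq R := [seq x%:R | x : nat <- enum_fset B].
have : (size rs < size (kron g))%N.
  apply: max_poly_roots => //.
    apply/allP => _ /mapP[x xB ->]; rewrite /root horner_kron gW //; exact: BW.
  by rewrite map_inj_uniq ?fset_uniq // => x y /eqP; rewrite eqr_nat => /eqP.
by rewrite size_map ltnNge szB.
Qed.

End Kronecker.

(** * Sums of squares *)

(** Let m be the largest leading monomial among the summands.  The coefficient of
    m^2 in the sum is a sum of squares which are not all 0, so m^2 has
    degree at most 2d. *)
Lemma msize_sos_summand (R : realDomainType) n d (s : seq {mpoly R[n]}) :
  (msize (\sum_(g <- s) g ^+ 2) <= (2 * d).+1)%N ->
  forall g, g \in s -> (msize g <= d.+1)%N.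
Proof.
move=> sz.
have [->//|[g0 [g0s g0_max]]] : s = [::] \/ exists g0, g0 \in s /\
    forall g, g \in s -> (mlead g <= mlead g0)%O.
  elim: s {sz} => [|g s IH]; [by left|right].
  case: IH => [->|[h [hs h_max]]].
    by exists g; split=> [|k]; rewrite inE // => /eqP->.
  have [gh|/ltW hg] := leP (mlead g) (mlead h).
    by exists h; split=> [|k]; rewrite inE ?hs ?orbT // => /predU1P[->|/h_max].
  exists g; split=> [|k]; rewrite inE ?eqxx // => /predU1P[->//|/h_max kh].
  exact: le_trans kh hg.
suff deg_g0 : (mdeg (mlead g0) <= d)%N.
  move=> g gs; have [->|g_neq0] := eqVneq g 0; first by rewrite msize0.
  by rewrite -mlead_deg // ltnS (leq_trans _ deg_g0) // lemc_mdeg // g0_max.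
have [->|g0_neq0] := eqVneq g0 0; first by rewrite mlead0 mdeg0.
set m := mlead g0.
have coef_m : (\sum_(g <- s) g ^+ 2)@_(m + m) != 0.
  rewrite raddf_sum /= big_seq.
  rewrite (eq_bigr (fun g => (g@_m) ^+ 2)) => [|g gs]; last first.
    by rewrite expr2 mleadcMW ?g0_max.
  rewrite -big_seq psumr_eq0 => [|g _]; last exact: sqr_ge0.
  by apply/allPn; exists g0 => //=; rewrite sqrf_eq0 mleadc_eq0.
have : (mdeg (m + m)%MM < (2 * d).+1)%N.
  apply: leq_trans sz; apply: msize_mdeg_lt.
  by apply: contraR coef_m => /memN_msupp_eq0->.
by rewrite mdegD addnn -mul2n ltnS leq_pmul2l.
Qed.

Lemma meval_sos_ge0 (R : realType) n (p : {mpoly R[n]}) (x : 'I_n -> R) :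
  is_sos p -> 0 <= p.@[x].
Proof.
case=> s ->; rewrite raddf_sum /= sumr_ge0 // => g _.
by rewrite rmorphXn sqr_ge0.
Qed.

(** * Lifts *)

Lemma least_pos_eq (P : nat -> Prop) j : (0 < j)%N -> P j ->
  (forall i, P i -> (j <= i)%N) -> least_pos P = Some j.
Proof.
move=> j0 Pj min_j; rewrite /least_pos; case: pselect => [ex|[]]; last first.
  by exists j; apply/asboolP.
case: ex_minnP => i /asboolP[_ Pi] min_i; congr Some; apply/eqP.
by rewrite eqn_leq min_j // min_i //; apply/asboolP.
Qed.

Section LiftTransfer.
Variable R : realType.

(** Along a split surjection q, both the affine subspace and the cone can be pulled
    back without changing the image. *)
Lemma has_lift_preimage (E E' : vectType R) (q : {linear E' -> E})
    (s : E -> E') (K : set E) (V : lmodType R) (S : set V) :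
  cancel s q -> has_lift K S -> has_lift (q @^-1` K) S.
Proof.
move=> sK [_ [pi [[a [U ->]] ->]]].
exists (q @^-1` [set x | x - a \in U]), (pi \o q); split.
  exists (s a), (linfun q @^-1: U)%VS; apply/seteqP; split=> x /=;
    by rewrite -memv_preim lfunE /= linearB /= sK.
apply/seteqP; split=> [_ [x [Kx Hx] <-]|_ [x [Kx Hx] <-]].
  by exists (s x) => /=; rewrite ?sK.
by exists (q x).
Qed.

Definition pow_mx j m (i : 'I_m) (A : {ffun 'I_m -> symmx R j}) : 'M[R]_j :=
  vsval (A i).

Fact pow_mx_is_linear j m i : linear (@pow_mx j m i).
Proof. by move=> a A B; rewrite /pow_mx !ffunE linearP. Qed.

HB.instance Definition _ j m i := GRing.isLinear.Build R
  {ffun 'I_m -> symmx R j} 'M[R]_j _ (@pow_mx j m i) (pow_mx_is_linear i).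

Definition first_block j (A : {ffun 'I_1 -> symmx R j}) : symmx R j := A ord0.

Fact first_block_is_linear j : linear (@first_block j).
Proof. by move=> a A B; rewrite /first_block !ffunE. Qed.

HB.instance Definition _ j := GRing.isLinear.Build R
  {ffun 'I_1 -> symmx R j} (symmx R j) _ (@first_block j)
  (@first_block_is_linear j).

Lemma has_lift_psd_pow1 j (V : lmodType R) (S : set V) :
  has_lift (@psd R j) S -> has_lift (@psd_pow R j 1) S.
Proof.
move=> liftS; rewrite (_ : @psd_pow R j 1 = @first_block j @^-1` @psd R j).
  apply: (@has_lift_preimage _ _ (@first_block j) (fun A => [ffun=> A])) => //.
  by move=> A; rewrite /= /first_block ffunE.
by apply/seteqP; split=> A; [exact | move=> A0 i; rewrite ord1].
Qed.

Lemma psdP j (A : symmx R j) : psd A <-> psdmx (vsval A).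
Proof.
split=> [pA|[_ pA] x]; last by have := pA x^T; rewrite trmxK.
split=> [|u]; first by apply/eqP; rewrite -memv_symv subvsP.
by have := pA u^T; rewrite trmxK.
Qed.

End LiftTransfer.

(** * The Gram matrix lift *)

Section GramLift.
Variables (R : realType) (n d : nat).
Notation D := #|{: 'X_{1..n < d.+1}}|.

Definition gram (A : 'M[R]_D) : {mpoly R[n]} :=
  \sum_a \sum_b A a b *: 'X_[monom a + monom b].

Fact gram_is_linear : linear gram.
Proof.
move=> c A B; rewrite /gram scaler_sumr -big_split; apply: eq_bigr => a _ /=.
rewrite scaler_sumr -big_split; apply: eq_bigr => b _ /=.
by rewrite !mxE scalerDl scalerA.
Qed.

HB.instance Definition _ :=
  GRing.isLinear.Build R 'M[R]_D {mpoly R[n]} _ gram gram_is_linear.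

Lemma gram_sqr v : gram (v^T *m v) = vec_poly v ^+ 2.
Proof.
rewrite expr2 /vec_poly mulr_suml; apply: eq_bigr => a _.
rewrite mulr_sumr; apply: eq_bigr => b _.
by rewrite mpolyXD -scalerAl -scalerAr scalerA mxE big_ord1 mxE.
Qed.

Lemma gram_deg A : gram A \in @deg_le n (2 * d)%N R.
Proof.
apply: rpred_sum => a _; apply: rpred_sum => b _; apply: rpredZ.
by rewrite inE msizeX ltnS mdegD mul2n -addnn leq_add ?mdeg_monom.
Qed.

Definition gram_map (A : symmx R D) : bmpoly n (2 * d)%N R :=
  BMPoly (gram_deg (vsval A)).

Fact gram_map_is_linear : linear gram_map.
Proof. by move=> c A B; apply: val_inj; rewrite /= !linearP. Qed.

HB.instance Definition _ :=
  GRing.isLinear.Build R (symmx R D) (bmpoly n (2 * d)%N R) _ gram_map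
    gram_map_is_linear.

(** The affine subspace is the whole space: the Gram map sends the cone of positive
    semidefinite matrices onto the sums of squares. *)
Lemma sos_cone_has_lift : has_lift (@psd R D) (sos_cone R n (2 * d)%N).
Proof.
exists setT, gram_map; split.
  by exists 0, fullv; apply/seteqP; split=> x // _ /=; rewrite memvf.
rewrite setIT; apply/seteqP; split=> [p [s ps]|_ [A /psdP/psdmx_sum_sqr[s As] <-]].
  have deg_s g : g \in s -> (msize g <= d.+1)%N.
    by apply: msize_sos_summand; rewrite -ps; case: p {ps}.
  pose w g : 'rV[R]_D := \row_a g@_(monom a).
  pose A := \sum_(g <- s) (w g)^T *m w g.
  have sA : A \in symv R D.
    rewrite memv_symv /A linear_sum /=; apply/eqP/eq_bigr => g _.
    by rewrite trmx_mul trmxK.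
  exists (Subvs sA); last first.
    apply: val_inj; rewrite /= ps linear_sum !big_seq; apply: eq_bigr => g gs.
    by rewrite /= gram_sqr vec_poly_coeffs ?deg_s.
  apply/psdP; split=> [|u] /=; first by apply/eqP; rewrite -memv_symv.
  rewrite mulmx_sumr mulmx_suml summxE sumr_ge0 // => g _.
  rewrite mulmxA -mulmxA -[w g in X in _ *m X]trmxK -trmx_mul mxE big_ord1.
  by rewrite [X in _ * X]mxE -expr2 sqr_ge0.
exists (map (@vec_poly _ _ _) s).
rewrite /= As linear_sum big_map; apply: eq_bigr => v _; exact: gram_sqr.
Qed.

End GramLift.

(** * The lower bound *)

Section LowerBound.
Variables (R : realType) (n d j m : nat).

(** The subspaces N(x,i) are the kernels of the blocks of a matrix A x
    of maximal rank in the face of the point pt x. *)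
Lemma psd_pow_lift_size : has_lift (@psd_pow R j m) (sos_cone R n (2 * d)%N) ->
  (#|{: 'X_{1..n < d.+1}}| <= j)%N.
Proof.
move=> [H [pi [[a [U HE]] SE]]]; rewrite leqNgt; apply/negP => lt_jD.
have inS A : (H A /\ forall i, psdmx (pow_mx i A)) <-> (@psd_pow R j m `&` H) A.
  by split=> [[HA pA]|[pA HA]]; split=> // i; apply/psdP; apply: pA.
have H_line A B t : H A -> H B -> H (A + t *: (B - A)).
  rewrite HE /= => HA HB.
  have -> : A + t *: (B - A) - a = (A - a) + t *: ((B - a) - (A - a)).
    by rewrite opprB addrA subrK addrAC.
  by apply: rpredD => //; apply: rpredZ; apply: rpredB.
pose q (i : 'I_m) : {linear {ffun 'I_m -> symmx R j} -> 'M[R]_j} :=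
  @pow_mx R j m i.
pose pt (x : nat) : 'I_n -> R := kron_pt d x%:R.
pose ev x (A : {ffun 'I_m -> symmx R j}) : R := (mpoly_of_bmpoly (pi A)).@[pt x].
have ev_lin x : scalar (ev x).
  by move=> c A B; rewrite /ev linearP /= linearP.
pose l x : {scalar {ffun 'I_m -> symmx R j}} :=
  HB.pack (ev x) (GRing.isLinear.Build _ _ _ _ (ev x) (ev_lin x)).
have l_ge0 x A : (H A /\ forall i, psdmx (q i A)) -> 0 <= l x A.
  move=> /inS SA; apply: meval_sos_ge0.
  have : sos_cone R n (2 * d)%N (pi A) by rewrite SE; exists A.
  by [].
have face0 x : exists2 A, H A /\ (forall i, psdmx (q i A)) & l x A = 0.
  have : sos_cone R n (2 * d)%N 0 by exists [::]; rewrite big_nil.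
  rewrite SE => -[A /inS SA piA]; exists A => //.
  by rewrite /= /ev piA meval0.
have least x : exists A, [/\ H A /\ (forall i, psdmx (q i A)), l x A = 0 &
    forall B, H B /\ (forall i, psdmx (q i B)) -> l x B = 0 ->
      forall i, (kermx (q i A) <= kermx (q i B))%MS].
  have [A [SA lA] leA] := exists_least_kernels H_line (face0 x).
  by exists A.
have [A AP] := choice least.
(* Start from C = 0, whose codimension j is the number of points allowed. *)
have [|T [W [szT Winf] TW]] := @exists_absorbing_set _ m j j
    (fun x i => kermx (q i (A x))) (fun=> 0) setT infinite_nat.
  by move=> i; left; rewrite mxrank0.
have [|g [g_neq0 gd gT]] := @exists_vanishing_mpoly R n d (map pt T).
  by rewrite size_map (leq_ltn_trans szT).
have g2_deg : g ^+ 2 \in @deg_le n (2 * d)%N R.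
  rewrite inE expr2 msizeM //; move: (mmeasure _ g) gd => k; lia.
have : sos_cone R n (2 * d)%N (BMPoly g2_deg).
  by exists [:: g]; rewrite big_seq1.
rewrite SE => -[B /inS SB piB].
have lB x : l x B = g.@[pt x] ^+ 2 by rewrite /= /ev piB /= rmorphXn.
suff g_zero x : W x -> g.@[pt x] = 0.
  by move/eqP: g_neq0; apply; apply: mpoly_eq0_infinite_zeros gd Winf g_zero.
move=> Wx; apply/eqP; rewrite -sqrf_eq0 -lB; apply/eqP.
have [SA lA _] := AP x.
apply: (zero_of_kernels H_line (l_ge0 x) SA lA SB) => i.
apply: (TW x i) => // [|y yT]; first exact: sub0mx.
have [_ _ leA] := AP y; apply: leA => //; rewrite lB.
have := gT (index y T); rewrite size_map index_mem => /(_ yT).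
by rewrite (nth_map 0%N) ?index_mem // nth_index // => ->; rewrite expr0n.
Qed.

End LowerBound.

Local Close Scope ring_scope.
Local Close Scope classical_set_scope.

Theorem corollary4 (R : realType) (n d : nat) (hn : (0 < n)%N) :
  sxdeg (sos_cone R n (2 * d)) = sxc (sos_cone R n (2 * d)) /\
  sxc (sos_cone R n (2 * d)) = Some 'C(n + d, n).
Proof.
have bin_pos : (0 < 'C(n + d, n))%N by rewrite bin_gt0 leq_addr.
have lift_D := sos_cone_has_lift R n d.
rewrite card_bmultinom in lift_D.
have sxcE : sxc (sos_cone R n (2 * d)) = Some 'C(n + d, n).
  apply: least_pos_eq => // j /has_lift_psd_pow1/psd_pow_lift_size.
  by rewrite card_bmultinom.
split=> //; rewrite sxcE; apply: least_pos_eq => //.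
  by exists 1%N; split=> //; apply: has_lift_psd_pow1.
by move=> j [m [_ /psd_pow_lift_size]]; rewrite card_bmultinom.
Qed.
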